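(* Let $d, N$ be positive integers, let $P \in \mathcal M_N(\mathbb R)$ be a stochastic matrix, let $\nu \in \mathbb R^N$ be an invariant probability for $P$, and let $\mathcal A = (A_1, \dotsc, A_N) \in \mathcal M_d(\mathbb R)^N$. Then the following statements are equivalent: (a) $\rho_{\mathrm d}(\mathcal A) = \rho_{\mathrm p}(\nu, P, \mathcal A)$. (b) $\rho(A_{i_k} \dotsm A_{i_1})^{1/k} = \rho_{\mathrm d}(\mathcal A)$ for every $(\nu, P)$-cycle $(i_1, \dotsc, i_k)$.
   Context: $\mathcal M_n(\mathbb R)$ is the space of $n\times n$ real matrices; $\rho(M)$ is the spectral radius of $M$; $\|\cdot\|$ is any norm on $\mathcal M_d(\mathbb R)$ induced by a norm on $\mathbb R^d$ (the quantities below do not depend on this choice). A matrix $P = (p_{ij})_{1\le i,j\le N}$ with nonnegative entries is stochastic if $\sum_{j=1}^N p_{ij} = 1$ for every $i$. A row vector $\nu = (\nu_1,\dotsc,\nu_N)$ is an invariant probability for $P$ if $\nu_i \ge 0$ for all $i$, $\sum_i \nu_i = 1$ and $\nu = \nu P$. For $k \ge 1$ and $i_1,\dotsc,i_k \in \{1,\dotsc,N\}$, $(i_1,\dotsc,i_k)$ is a $P$-cycle if $p_{i_1 i_2} p_{i_2 i_3}\dotsm p_{i_{k-1} i_k} p_{i_k i_1} > 0$ (for $k=1$: $p_{i_1 i_1}>0$); it is a $(\nu,P)$-cycle if moreover $\nu_{i_1} > 0$. The deterministic joint spectral radius is $$\rho_{\mathrm d}(\mathcal A) = \limsup_{n\to\infty}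 \max_{(i_1,\dotsc,i_n)\in\{1,\dotsc,N\}^n} \|A_{i_n}\dotsm A_{i_1}\|^{1/n}.$$ The probabilistic joint spectral radius is $$\rho_{\mathrm p}(\nu,P,\mathcal A) = \limsup_{n\to\infty} \sum_{(i_1,\dotsc,i_n)\in\{1,\dotsc,N\}^n} \nu_{i_1} p_{i_1 i_2}\dotsm p_{i_{n-1} i_n} \|A_{i_n}\dotsm A_{i_1}\|^{1/n}.$$ *)

(* Defs.v *)
From mathcomp Require Import all_boot all_order all_algebra.
From mathcomp Require Import complex.
From mathcomp Require Import boolp classical_sets reals topology normedtype.
From mathcomp Require Import sequences exp.

Set Implicit Arguments.
Unset Strict Implicit.
Unset Printing Implicit Defensive.

Import Order.TTheory GRing.Theory Num.Theory.

Local Open Scope classical_set_scope.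
Local Open Scope ring_scope.

Record is_norm (R : realType) (d : nat) (nv : 'cV[R]_d -> R) : Prop := IsNorm {
  is_norm_ge0 : forall x, 0 <= nv x;
  is_norm_eq0 : forall x, nv x = 0 -> x = 0;
  is_normZ : forall (a : R) x, nv (a *: x) = `|a| * nv x;
  is_normD : forall x y, nv (x + y) <= nv x + nv y
}.

Definition induced_norm (R : realType) (d : nat) (nv : 'cV[R]_d -> R)
    (M : 'M[R]_d) : R :=
  sup [set nv (M *m x) | x in [set x : 'cV[R]_d | nv x <= 1]].

(* The eigenvalues are those of M as a complex matrix. MathComp's [eigenvalue]
   is phrased with row eigenvectors, which does not affect the spectrum. *)
Definition spectral_radius (R : realType) (d : nat) (M : 'M[R]_d) : R :=
  sup [set Normc.normc z | z in
         [set z : R[i] | eigenvalue (map_mx (real_complex R) M) z]].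

Definition stochastic (R : realType) (N : nat) (P : 'M[R]_N) : Prop :=
  (forall i j, 0 <= P i j) /\ (forall i, \sum_j P i j = 1).

Definition invariant_probability (R : realType) (N : nat) (nu : 'rV[R]_N)
    (P : 'M[R]_N) : Prop :=
  [/\ forall i, 0 <= nu 0 i, \sum_i nu 0 i = 1 & nu = nu *m P].

(* path_weight P i [:: j1; ...; jm] = p_{i j1} p_{j1 j2} ... p_{j(m-1) jm} *)
Fixpoint path_weight (R : realType) (N : nat) (P : 'M[R]_N) (i : 'I_N)
    (s : seq 'I_N) : R :=
  if s is j :: s' then P i j * path_weight P j s' else 1.

(* nu_{i1} p_{i1 i2} ... p_{i(n-1) in}; the value on the empty word plays no
   role in the limsup below. *)
Definition word_weight (R : realType) (N : nat) (nu : 'rV[R]_N) (P : 'M[R]_N)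
    (w : seq 'I_N) : R :=
  if w is i :: s then nu 0 i * path_weight P i s else 1.

Definition P_cycle (R : realType) (N : nat) (P : 'M[R]_N) (w : seq 'I_N) : Prop :=
  if w is i :: s then 0 < path_weight P i (rcons s i) else False.

Definition nu_P_cycle (R : realType) (N : nat) (nu : 'rV[R]_N) (P : 'M[R]_N)
    (w : seq 'I_N) : Prop :=
  P_cycle P w /\ (if w is i :: _ then 0 < nu 0 i else False).

(* word_mx A [:: i1; ...; in] = A_{in} ... A_{i1}: the first letter acts first. *)
Definition word_mx (R : realType) (d N : nat) (A : 'I_N -> 'M[R]_d)
    (w : seq 'I_N) : 'M[R]_d :=
  foldl (fun M i => A i *m M) 1%:M w.

(* Both sequences below are bounded, so that the real-valued [limn_sup] is the
   limsup; their term at n = 0 is irrelevant. The maximum is over a nonempty set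
   of nonnegative numbers when 0 < N, hence the default value 0. *)
Definition rho_d (R : realType) (d N : nat) (nv : 'cV[R]_d -> R)
    (A : 'I_N -> 'M[R]_d) : R :=
  limn_sup (fun n : nat =>
    \big[Num.max/0]_(w : n.-tuple 'I_N)
      (induced_norm nv (word_mx A w) `^ n%:R^-1)).

Definition rho_p (R : realType) (d N : nat) (nv : 'cV[R]_d -> R)
    (nu : 'rV[R]_N) (P : 'M[R]_N) (A : 'I_N -> 'M[R]_d) : R :=
  limn_sup (fun n : nat =>
    \sum_(w : n.-tuple 'I_N)
      word_weight nu P w * induced_norm nv (word_mx A w) `^ n%:R^-1).

(* Main.v *)
(** Equality of the two radii can only fail through a contracting cycle.

    If a (nu, P)-cycle w satisfies rho(A_w)^(1/k) < theta < rho_d, then the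
    coefficients of X^m modulo the characteristic polynomial of A_w decay like
    r^m with r < theta^k, so some power A_w^m contracts by theta^(k m) in every
    norm in which A_w has a given Lipschitz bound. This applies with one and the
    same m to the norms sup_v nv(A_v x) / (rho_d + e)^|v|, in which every A_i is
    (rho_d + e)-Lipschitz. By stationarity the word w^m, of probability p > 0,
    fills a proportion p of the consecutive blocks of length k m, and the AM-GM
    inequality gives rho_p <= (rho_d + e) - p (rho_d + e - theta); as m, p and
    theta do not depend on e, letting e -> 0 gives rho_p < rho_d.

    Conversely, nu charges only recurrent states, so every word of positive
    weight extends by boundedly many letters to a cycle. If all cycles have
    spectral radius rho_d^length, then ||A_w|| >= c rho_d^|w| for all words w of
    positive weight, hence rho_p >= rho_d. *)

Require Import Defs.
From mathcomp Require Import all_boot all_order all_algebra.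
From mathcomp Require Import complex.
From mathcomp Require Import boolp classical_sets reals topology normedtype.
From mathcomp Require Import sequences exp.
From mathcomp Require Import derive lra ring zify.

Set Implicit Arguments.
Unset Strict Implicit.
Unset Printing Implicit Defensive.

Import Order.TTheory GRing.Theory Num.Theory.
Import numFieldNormedType.Exports.

Local Open Scope classical_set_scope.
Local Open Scope ring_scope.

(** * Norms on column vectors *)

Lemma coord_le_mx_norm (R : realType) (m n : nat) (v : 'M[R]_(m, n)) i j :
  `|v i j| <= `|v|.
Proof.
have /mapP[k _ ->] : `|v i j| \in [seq `|v x.1 x.2| | x : 'I_m * 'I_n].
  by apply/mapP; exists (i, j); rewrite //= mem_enum.
by rewrite [leRHS]/Num.norm /= mx_normrE; apply/bigmax_geP; right => /=; exists k.
Qed.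

Section VectorNorms.
Variables (R : realType) (d : nat) (nv : 'cV[R]_d -> R).
Hypothesis hnv : is_norm nv.

Lemma is_norm0 : nv 0 = 0.
Proof. by rewrite -(scale0r 0) (is_normZ hnv) normr0 mul0r. Qed.

Lemma is_norm_sum (I : Type) (s : seq I) (F : I -> 'cV[R]_d) :
  nv (\sum_(i <- s) F i) <= \sum_(i <- s) nv (F i).
Proof.
elim/big_ind2 : _ => [|x x' y y' le1 le2|//]; first by rewrite is_norm0.
exact: le_trans (is_normD hnv _ _) (lerD le1 le2).
Qed.

Lemma is_norm_le_coord : exists2 C, 0 < C &
  forall x : 'cV[R]_d, nv x <= C * \sum_i `|x i 0|.
Proof.
exists (1 + \sum_i nv (delta_mx i 0)).
  by rewrite ltr_pwDl// sumr_ge0// => i _; exact: is_norm_ge0 hnv _.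
move=> x.
have {1}-> : x = \sum_i x i 0 *: delta_mx i 0.
  apply/matrixP => i j; rewrite ord1 summxE (bigD1 i)//= !mxE !eqxx mulr1.
  by rewrite big1 ?addr0// => k ki; rewrite !mxE eq_sym (negPf ki) mulr0.
apply: le_trans (is_norm_sum _ _) _; rewrite mulr_sumr ler_sum// => i _.
rewrite (is_normZ hnv) mulrC ler_wpM2r// (bigD1 i)//= addrCA lerDl.
by rewrite addr_ge0// sumr_ge0// => j _; exact: is_norm_ge0 hnv _.
Qed.

Lemma is_norm_le_mx_norm : exists2 C, 0 < C &
  forall v : 'rV[R]_d, nv v^T <= C * `|v|.
Proof.
have [C C0 hC] := is_norm_le_coord.
exists (C * (1 + d%:R)); first by rewrite mulr_gt0// ltr_pwDl.
move=> v; apply: le_trans (hC _) _; rewrite -mulrA ler_pM2l//.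
apply: (@le_trans _ _ (\sum_(i < d) `|v|)).
  by apply: ler_sum => i _; rewrite mxE coord_le_mx_norm.
by rewrite sumr_const card_ord -(mulr_natl `|v|) ler_wpM2r// lerDr.
Qed.

(** Equivalence of norms by compactness: [nv] has a positive minimum on the unit sphere of the sup
    norm. Row vectors appear because the extreme value theorem [EVT_min_rV] is stated for them. *)
Lemma mx_norm_le_is_norm : exists2 C, 0 < C &
  forall v : 'rV[R]_d, `|v| <= C * nv v^T.
Proof.
pose f (v : 'rV[R]_d) := nv v^T.
have [K K0 fK] := is_norm_le_mx_norm.
pose S : set 'rV[R]_d := [set v | `|v| = 1].
(* The sphere is empty only in dimension 0. *)
have [S0|S0] := pselect (S !=set0); last first.
  exists 1 => // v; have [->|v0] := eqVneq v 0.
    by rewrite normr0 mulr_ge0// (is_norm_ge0 hnv).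
  case: S0; exists (`|v|^-1 *: v); rewrite /S /=.
  by rewrite normrZ gtr0_norm ?invr_gt0 ?normr_gt0// mulVf// normr_eq0.
(* The reverse triangle inequality makes [f] Lipschitz, hence continuous. *)
have fB v w : `|f v - f w| <= K * `|v - w|.
  rewrite ler_norml; apply/andP; split.
    rewrite -normrN opprB lerNl opprB lerBlDr; apply: le_trans (lerD (fK _) (lexx _)).
    by rewrite /f -[X in nv X <= _](subrK v^T) -linearB /=; exact: is_normD hnv _ _.
  rewrite lerBlDr; apply: le_trans (lerD (fK _) (lexx _)).
  by rewrite /f -[X in nv X <= _](subrK w^T) -linearB /=; exact: is_normD hnv _ _.
have cf : continuous f.
  move=> v; have Fv : Filter (nbhs v) by exact: nbhs_filter.
  apply/(@cvgrPdist_le _ _ _ (nbhs v) Fv) => e e0.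
  have /cvgrPdist_le/(_ (e / K)) vv : w @[w --> v] --> v := cvg_id.
  apply: filterS (vv _) => [w vw|]; last by rewrite divr_gt0.
  by apply: le_trans (fB _ _) _; rewrite mulrC -ler_pdivlMr.
have cS : compact S.
  apply: bounded_closed_compact.
    by exists 1; split; rewrite ?num_real// => M M1 v /= ->; exact: ltW.
  rewrite (_ : S = (fun v : 'rV[R]_d => `|v|) @^-1` [set 1]) //.
  apply: closed_comp; last exact: closed_eq.
  by move=> x _; exact: norm_continuous.
have [c cS1 fmin] := EVT_min_rV S0 cS (continuous_subspaceT cf).
have fc0 : 0 < f c.
  rewrite lt_neqAle eq_sym (is_norm_ge0 hnv) andbT; apply/eqP => fc0.
  have c0 : c = 0 by apply: trmx_inj; rewrite trmx0; exact: is_norm_eq0 hnv _ fc0.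
  by move: cS1; rewrite inE /S /= c0 normr0 => /eqP; rewrite eq_sym oner_eq0.
exists (f c)^-1; rewrite ?invr_gt0// => v; rewrite mulrC ler_pdivlMr//.
have [->|v0] := eqVneq v 0; first by rewrite normr0 mul0r (is_norm_ge0 hnv).
have nv0 : 0 < `|v| by rewrite normr_gt0.
have : f c <= f (`|v|^-1 *: v).
  apply: fmin; rewrite inE /S /= normrZ gtr0_norm ?invr_gt0//.
  by rewrite mulVf// gt_eqF.
rewrite /f linearZ /= (is_normZ hnv) gtr0_norm ?invr_gt0// mulrC.
by rewrite ler_pdivlMr// mulrC.
Qed.

Lemma coord_le_is_norm : exists2 C, 0 < C &
  forall (x : 'cV[R]_d) i, `|x i 0| <= C * nv x.
Proof.
have [C C0 hC] := mx_norm_le_is_norm; exists C => // x i.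
rewrite -[x in leRHS]trmxK; apply: le_trans (hC _).
by have := coord_le_mx_norm x^T 0 i; rewrite mxE.
Qed.

Let nv_ge0 := is_norm_ge0 hnv.

(** Coordinates are bounded on the unit ball of [nv]; without this bound the [sup] in [induced_norm]
    would carry no information. *)
Lemma induced_norm_has_ub (M : 'M[R]_d) :
  has_ubound [set nv (M *m x) | x in [set x : 'cV[R]_d | nv x <= 1]].
Proof.
have [C C0 hC] := coord_le_is_norm; have [K K0 hK] := is_norm_le_coord.
exists (K * \sum_i \sum_j (`|M i j| * C)) => _ [x /= x1 <-].
apply: le_trans (hK _) _; rewrite ler_pM2l// ler_sum// => i _.
rewrite mxE; apply: le_trans (ler_norm_sum _ _ _) _; apply: ler_sum => j _.
rewrite normrM ler_wpM2l//; apply: le_trans (hC _ _) _.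
by rewrite -[leRHS]mulr1 ler_pM2l.
Qed.

Lemma induced_norm_ge0 (M : 'M[R]_d) : 0 <= induced_norm nv M.
Proof.
rewrite -is_norm0; apply: ub_le_sup; first exact: induced_norm_has_ub.
by exists 0; rewrite /= ?is_norm0// mulmx0 is_norm0.
Qed.

Lemma induced_norm_mulmx (M : 'M[R]_d) x :
  nv (M *m x) <= induced_norm nv M * nv x.
Proof.
have [->|x0] := eqVneq x 0; first by rewrite mulmx0 is_norm0 mulr0.
have nx0 : 0 < nv x.
  rewrite lt_neqAle eq_sym nv_ge0 andbT.
  by apply: contra_neq x0; exact: is_norm_eq0.
rewrite -ler_pdivrMr// mulrC -[X in X * _]gtr0_norm ?invr_gt0//.
rewrite -(is_normZ hnv) scalemxAr; apply: ub_le_sup; first exact: induced_norm_has_ub.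
exists ((nv x)^-1 *: x) => //=.
by rewrite (is_normZ hnv) gtr0_norm ?invr_gt0// mulVf// gt_eqF.
Qed.

Lemma induced_norm_le (M : 'M[R]_d) b :
  0 <= b -> (forall x, nv (M *m x) <= b * nv x) -> induced_norm nv M <= b.
Proof.
move=> b0 hM; apply: ge_sup.
  by exists (nv (M *m 0)); exists 0; rewrite //= is_norm0.
by move=> _ [x /= x1 <-]; apply: le_trans (hM _) _; rewrite ler_piMr.
Qed.

Lemma induced_normM (M M' : 'M[R]_d) :
  induced_norm nv (M *m M') <= induced_norm nv M * induced_norm nv M'.
Proof.
apply: induced_norm_le => [|x]; first by rewrite mulr_ge0 ?induced_norm_ge0.
rewrite -mulmxA -mulrA; apply: le_trans (induced_norm_mulmx _ _) _.
by rewrite ler_wpM2l ?induced_norm_ge0 ?induced_norm_mulmx.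
Qed.

(** Equality fails in dimension 0, where the induced norm vanishes. *)
Lemma induced_norm1_le1 : induced_norm nv 1%:M <= 1.
Proof. by apply: induced_norm_le => // x; rewrite mul1mx mul1r. Qed.

Lemma entry_le_induced_norm : exists2 C, 0 < C &
  forall (M : 'M[R]_d) i j, `|M i j| <= C * induced_norm nv M.
Proof.
have [C C0 hC] := coord_le_is_norm; have [K K0 hK] := is_norm_le_coord.
exists (C * K); rewrite ?mulr_gt0// => M i j.
have -> : M i j = (M *m delta_mx j 0 : 'cV_d) i 0.
  rewrite mxE (bigD1 j)//= !mxE !eqxx mulr1 big1 ?addr0// => k kj.
  by rewrite !mxE (negPf kj) mulr0.
apply: le_trans (hC _ _) _; rewrite -mulrA ler_pM2l//.
apply: le_trans (induced_norm_mulmx _ _) _; rewrite mulrC.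
apply: ler_wpM2r; first exact: induced_norm_ge0.
apply: le_trans (hK _) _; rewrite (bigD1 j)//= big1 => [|k kj].
  by rewrite !mxE !eqxx normr1 addr0 mulr1.
by rewrite !mxE (negPf kj) normr0.
Qed.

End VectorNorms.

(** * Limits superior and roots *)

Section LimSup.
Variables (R : realType) (u : nat -> R) (K : R).
Hypothesis uK : forall n, 0 <= u n <= K.

Let ubd : bounded_fun u.
Proof.
exists K; split; first exact: num_real.
move=> x Kx n _ /=; have /andP[u0 uk] := uK n.
by rewrite ger0_norm// (le_trans uk)// ltW.
Qed.

Let has_ub n : has_ubound (sdrop u n).
Proof. by exists K => _ [m _ <-]; have /andP[] := uK m. Qed.

Let sups_ge0 n : 0 <= sups u n.
Proof.
apply: (@le_trans _ _ (u n)); first by have /andP[] := uK n.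
by apply: ub_le_sup; [exact: has_ub|exists n => /=].
Qed.

(** For a bounded sequence the limit superior is the infimum of the tail suprema, so some tail
    supremum is below c. *)
Lemma limn_sup_lt_near c : limn_sup u < c -> \forall n \near \oo, u n < c.
Proof.
rewrite limn_supE// => /inf_lt [|_ [n _ <-] unc].
  by exists (sups u 0), 0%N.
exists n => // m /= nm; apply: le_lt_trans unc.
by apply: ub_le_sup; [exact: has_ub|exists m].
Qed.

Lemma limn_sup_le_near c : (\forall n \near \oo, u n <= c) -> limn_sup u <= c.
Proof.
move=> [n _ un]; rewrite limn_supE//; apply: (@le_trans _ _ (sups u n)).
  by apply: ge_inf; [exists 0 => _ [m _ <-]; exact: sups_ge0|exists n].
apply: ge_sup; first by exists (u n), n => /=.
by move=> _ [m /= nm <-]; exact: un.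
Qed.

Lemma limn_sup_ge_frequently c :
  (forall n, exists2 m, (n <= m)%N & c <= u m) -> c <= limn_sup u.
Proof.
move=> uc; rewrite limn_supE//; apply: lb_le_inf; first by exists (sups u 0), 0%N.
move=> _ [n _ <-]; have [m nm cm] := uc n; apply: le_trans cm _.
by apply: ub_le_sup; [exact: has_ub|exists m].
Qed.

Lemma limn_sup_le_cvg v l : (\forall n \near \oo, u n <= v n) ->
  v @ \oo --> l -> limn_sup u <= l.
Proof.
move=> uv vl; apply/ler_addgt0Pr => e e0; apply: limn_sup_le_near.
have vle : \forall n \near \oo, v n <= l + e.
  by apply: cvgr_le vl _ _; rewrite ltrDl.
by near=> n; apply: (@le_trans _ _ (v n)); near: n.
Unshelve. all: by end_near.
Qed.

Lemma limn_sup_ge_cvg v l : (\forall n \near \oo, v n <= u n) ->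
  v @ \oo --> l -> l <= limn_sup u.
Proof.
move=> uv vl; apply/ler_addgt0Pl => e e0; rewrite addrC -lerBlDr.
apply: limn_sup_ge_frequently => n.
have vle : \forall n \near \oo, l - e <= v n.
  by apply: cvgr_ge vl _ _; rewrite ltrBlDr ltrDl.
suff [m] : exists m, l - e <= v m /\ v m <= u m /\ (n <= m)%N.
  by case=> h1 [h2 h3]; exists m => //; exact: le_trans h1 h2.
near \oo => m; exists m; split; [|split]; near: m => //.
exact: nbhs_infty_ge.
Unshelve. all: by end_near.
Qed.

End LimSup.

Lemma limn_sup_le_limn_sup (R : realType) (u v : nat -> R) K :
  (forall n, 0 <= u n <= K) -> (forall n, 0 <= v n <= K) ->
  (forall n, u n <= v n) -> limn_sup u <= limn_sup v.
Proof.
move=> uK vK uv; apply/ler_addgt0Pr => e e0; apply: (limn_sup_le_near uK).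
have : limn_sup v < limn_sup v + e by rewrite ltrDl.
by move/(limn_sup_lt_near vK); apply: filterS => n /ltW; apply: le_trans.
Qed.

Section Roots.
Variable R : realType.

Lemma cvg_inv_natr : (fun n : nat => n%:R^-1) @ \oo --> (0 : R).
Proof. by rewrite -cvg_shiftS; exact: cvg_harmonic. Qed.

Implicit Types (x b : R) (n : nat).

Lemma root_powR_expn x n : (0 < n)%N -> 0 <= x -> (x `^ n%:R^-1) ^+ n = x.
Proof.
move=> n0 x0; rewrite -powR_mulrn ?powR_ge0// -powRrM mulVf ?powRr1//.
by rewrite pnatr_eq0 -lt0n.
Qed.

Lemma root_powR_le x b n : (0 < n)%N -> 0 <= x -> 0 <= b ->
  (x `^ n%:R^-1 <= b) = (x <= b ^+ n).
Proof.
move=> n0 x0 b0; rewrite -[in RHS](root_powR_expn n0 x0).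
by rewrite ler_pXn2r// nnegrE powR_ge0.
Qed.

Lemma root_powR_ge x b n : (0 < n)%N -> 0 <= x -> 0 <= b ->
  (b <= x `^ n%:R^-1) = (b ^+ n <= x).
Proof.
move=> n0 x0 b0; rewrite -[in RHS](root_powR_expn n0 x0).
by rewrite ler_pXn2r// nnegrE powR_ge0.
Qed.

(** This is why multiplicative constants in norm estimates do not affect either joint radius. *)
Lemma cvg_root_powR x : 0 < x -> (fun n => x `^ n%:R^-1) @ \oo --> (1 : R).
Proof.
move=> x0; have -> : (fun n : nat => x `^ n%:R^-1) = (fun n : nat => expR (n%:R^-1 * ln x)).
  by apply/funext => n; rewrite /powR gt_eqF.
have h0 : (fun n : nat => n%:R^-1 * ln x) @ \oo --> (0 : R).
  rewrite -[X in _ --> X](mul0r (ln x)).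
  by apply: cvgM; [exact: cvg_inv_natr|exact: cvg_cst].
by rewrite -[X in _ --> X]expR0; apply: continuous_cvg; [exact: continuous_expR|].
Qed.

End Roots.

(** * Growth of matrix products *)

Section Words.
Variables (R : realType) (d N : nat) (A : 'I_N -> 'M[R]_d).

Lemma word_mx_cons i w : word_mx A (i :: w) = word_mx A w *m A i.
Proof.
rewrite /word_mx /= mulmx1 -[A i in LHS]mul1mx.
by elim/last_ind: w => //= w j IH; rewrite -!cats1 !foldl_cat /= IH mulmxA.
Qed.

Lemma word_mx_cat u v : word_mx A (u ++ v) = word_mx A v *m word_mx A u.
Proof.
elim: u => [|i u IH]; first by rewrite /word_mx /= mulmx1.
by rewrite cat_cons !word_mx_cons IH mulmxA.
Qed.

End Words.

Lemma word_mx_repeat (R : realType) (d N : nat) (A : 'I_N -> 'M[R]_d.+1) m w :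
  word_mx A (flatten (nseq m w)) = word_mx A w ^+ m.
Proof. by elim: m => //= m IH; rewrite word_mx_cat IH exprSr. Qed.

Section Growth.
Variables (R : realType) (d N : nat) (nv : 'cV[R]_d -> R).
Hypothesis hnv : is_norm nv.
Variable A : 'I_N -> 'M[R]_d.

(** The summand 1 makes the powers of this bound nondecreasing in the exponent. *)
Definition generator_bound : R := 1 + \sum_i induced_norm nv (A i).

Let norm_ge0 := induced_norm_ge0 hnv.

Lemma generator_bound_ge1 : 1 <= generator_bound.
Proof. by rewrite lerDl sumr_ge0. Qed.

Lemma word_norm_le w : induced_norm nv (word_mx A w) <= generator_bound ^+ size w.
Proof.
have K0 : 0 <= generator_bound := le_trans ler01 generator_bound_ge1.
elim: w => [|i w IH]; first exact: induced_norm1_le1.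
rewrite word_mx_cons exprSr; apply: le_trans (induced_normM hnv _ _) _.
rewrite ler_pM// /generator_bound (bigD1 i)//= addrCA lerDl.
by rewrite addr_ge0// sumr_ge0.
Qed.

Lemma root_word_norm_bounds w :
  0 <= induced_norm nv (word_mx A w) `^ (size w)%:R^-1 <= generator_bound.
Proof.
rewrite powR_ge0 /=; have K1 := generator_bound_ge1.
(* For the empty word the exponent is the inverse of 0, that is 0, and the root is 1. *)
have [->|w0] := posnP (size w); first by rewrite invr0 powRr0.
by rewrite root_powR_le ?word_norm_le// (le_trans ler01).
Qed.

Definition max_root (n : nat) : R :=
  \big[Num.max/0]_(w : n.-tuple 'I_N) (induced_norm nv (word_mx A w) `^ n%:R^-1).

Lemma max_root_bounds n : 0 <= max_root n <= generator_bound.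
Proof.
apply/andP; split; first exact: bigmax_ge_id.
apply: bigmax_le => [|w _]; first exact: le_trans ler01 generator_bound_ge1.
by have := root_word_norm_bounds w; rewrite size_tuple => /andP[].
Qed.

Lemma root_word_norm_le_max w :
  induced_norm nv (word_mx A w) `^ (size w)%:R^-1 <= max_root (size w).
Proof.
by apply: (le_bigmax _ (fun w' : (size w).-tuple 'I_N =>
  induced_norm nv (word_mx A w') `^ (size w)%:R^-1) (in_tuple w)).
Qed.

Lemma rho_d_ge0 : 0 <= rho_d nv A.
Proof.
apply: (limn_sup_ge_frequently max_root_bounds) => n.
by exists n => //; have /andP[] := max_root_bounds n.
Qed.

(** Beyond some length [n0] all roots are below s and the constant 1 suffices; the sum of the (K /
    s)^n absorbs the finitely many shorter lengths. *)
Lemma word_norm_growth s : rho_d nv A < s -> exists2 C, 1 <= C &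
  forall w, induced_norm nv (word_mx A w) <= C * s ^+ size w.
Proof.
move=> rs; have s0 : 0 < s := le_lt_trans rho_d_ge0 rs.
have [n0 _ hn0] := limn_sup_lt_near max_root_bounds rs.
pose K := generator_bound.
have K0 : 0 <= K := le_trans ler01 generator_bound_ge1.
have t0 n : 0 <= (K / s) ^+ n by rewrite exprn_ge0// divr_ge0// ltW.
exists (1 + \sum_(n < n0.+1) (K / s) ^+ n) => [|w]; first by rewrite lerDl sumr_ge0.
have [wn|nw] := leqP (size w) n0.
  apply: le_trans (word_norm_le w) _.
  rewrite -[generator_bound](@divfK _ s) ?gt_eqF// exprMn ler_wpM2r ?exprn_ge0 ?(ltW s0)//.
  rewrite (bigD1 (Ordinal (wn : (size w < n0.+1)%N)))//= addrCA lerDl.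
  by rewrite addr_ge0// sumr_ge0.
apply: (@le_trans _ _ (s ^+ size w)); last first.
  by rewrite ler_peMl ?exprn_ge0 ?(ltW s0)// lerDl sumr_ge0.
rewrite -root_powR_le//; [|exact: leq_trans nw|exact: ltW].
by apply: ltW; apply: le_lt_trans (root_word_norm_le_max w) _; exact: hn0 (ltnW nw).
Qed.

End Growth.

(** * Spectral radius *)

Section ComplexNorm.
Variable R : realType.
Implicit Types z : R[i].
Local Notation normc := (@Normc.normc R).

Lemma normc_ge0 z : 0 <= normc z.
Proof. by case: z => a b; exact: sqrtr_ge0. Qed.

Lemma normc_real (x : R) : normc (real_complex R x) = `|x|.
Proof. by rewrite /= expr0n addr0 sqrtr_sqr. Qed.

Lemma normc_add z z' : normc (z + z') <= normc z + normc z'.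
Proof. exact: (@le_normcD R z z'). Qed.

Lemma normc_sum (I : Type) (s : seq I) (F : I -> R[i]) :
  normc (\sum_(i <- s) F i) <= \sum_(i <- s) normc (F i).
Proof.
elim/big_ind2 : _ => [|x x' y y' le1 le2|//]; first by rewrite Normc.normc0.
exact: le_trans (normc_add _ _) (lerD le1 le2).
Qed.

Lemma normc_exp z n : normc (z ^+ n) = normc z ^+ n.
Proof.
by elim: n => [|n IH]; [exact: Normc.normc1|rewrite !exprS Normc.normcM IH].
Qed.

End ComplexNorm.

Section SpectralRadius.
Variables (R : realType) (d : nat).
Implicit Types M : 'M[R]_d.+1.
Local Notation normc := (@Normc.normc R).
Local Notation complexify M := (map_mx (real_complex R) M).

(** The eigenvector equation is read at the coordinate of largest modulus. *)
Lemma eigenvalue_le_entries M z : eigenvalue (complexify M) z ->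
  normc z <= \sum_i \sum_j `|M i j|.
Proof.
case/eigenvalueP => v vM v0.
have [i0 _ imax] := arg_maxP (fun i => normc (v 0 i)) (erefl : xpredT (0 : 'I_d.+1)).
have vi0 : 0 < normc (v 0 i0).
  rewrite lt_neqAle normc_ge0 andbT eq_sym; apply: contra v0 => /eqP vi0.
  apply/eqP/matrixP => i j; rewrite ord1 mxE; apply: Normc.eq0_normc.
  by apply/eqP; rewrite eq_le normc_ge0 andbT; apply: le_trans (imax j isT) _; rewrite vi0.
rewrite -(ler_pM2r vi0) -Normc.normcM.
have <- : (v *m complexify M) 0 i0 = z * v 0 i0 by rewrite vM mxE.
rewrite mxE; apply: le_trans (normc_sum _ _) _; rewrite mulr_suml ler_sum// => i _.
rewrite Normc.normcM mxE normc_real mulrC.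
apply: (@le_trans _ _ (`|M i i0| * normc (v 0 i0))).
  by rewrite ler_wpM2l//; exact: imax.
by rewrite ler_wpM2r ?normc_ge0// (bigD1 i0)//= lerDl sumr_ge0.
Qed.

Lemma eigenvalue_le_spectral_radius M z : eigenvalue (complexify M) z ->
  normc z <= spectral_radius M.
Proof.
move=> ez; apply: ub_le_sup; last by exists z.
by exists (\sum_i \sum_j `|M i j|) => _ [z' /= /eigenvalue_le_entries ? <-].
Qed.

(** Bounding a supremum requires a nonempty set: the characteristic polynomial has degree d + 1 and
    therefore a complex root. *)
Lemma spectral_radius_le M b :
  (forall z, eigenvalue (complexify M) z -> normc z <= b) -> spectral_radius M <= b.
Proof.
move=> hb; apply: ge_sup; last by move=> _ [z /= ez <-]; exact: hb.
have : size (char_poly (complexify M)) != 1%N by rewrite size_char_poly.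
case/closed_rootP => z; rewrite -eigenvalue_root_char => ez.
by exists (normc z), z.
Qed.

Lemma spectral_radius_ge0 M : 0 <= spectral_radius M.
Proof.
have : size (char_poly (complexify M)) != 1%N by rewrite size_char_poly.
case/closed_rootP => z; rewrite -eigenvalue_root_char.
by move/eigenvalue_le_spectral_radius; apply: le_trans; exact: normc_ge0.
Qed.

Lemma eigenvalue_exp (F : fieldType) (B : 'M[F]_d.+1) a m :
  eigenvalue B a -> eigenvalue (B ^+ m) (a ^+ m).
Proof.
case/eigenvalueP => v vB v0; apply/eigenvalueP; exists v => //.
elim: m => [|m IH]; first by rewrite !expr0 mulmx1 scale1r.
by rewrite exprSr mulmxA IH -scalemxAl vB scalerA -exprSr.
Qed.

Lemma spectral_radius_exp M m :
  spectral_radius M ^+ m.+1 <= spectral_radius (M ^+ m.+1).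
Proof.
(* Taking a root leaves a bare spectral radius on the left, which can then be bounded eigenvalue by
   eigenvalue. *)
rewrite -root_powR_ge ?spectral_radius_ge0//.
apply: spectral_radius_le => z ez.
rewrite root_powR_ge ?spectral_radius_ge0 ?normc_ge0// -normc_exp.
apply: eigenvalue_le_spectral_radius; rewrite rmorphXn /=; exact: eigenvalue_exp.
Qed.

Lemma spectral_radius_le_norm (nv : 'cV[R]_d.+1 -> R) : is_norm nv ->
  exists2 C, 0 < C & forall M, spectral_radius M <= C * induced_norm nv M.
Proof.
move=> /entry_le_induced_norm[C C0 hC].
exists (\sum_(i < d.+1) \sum_(j < d.+1) C) => [|M].
  do 2![rewrite big_ord_recl ltr_wpDr ?sumr_ge0// => *; rewrite ?sumr_ge0 ?ltW//].
apply: spectral_radius_le => z /eigenvalue_le_entries; move/le_trans; apply.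
by rewrite mulr_suml ler_sum// => i _; rewrite mulr_suml ler_sum.
Qed.

End SpectralRadius.

(** * Powers of a matrix modulo its characteristic polynomial *)

Section CharPolyRemainders.
Variable R : realType.
Local Notation normc := (@Normc.normc R).

(** A first-order recurrence with multiplier z, |z| < r, and forcing of order r^m has solutions of
    order r^m: the induction closes as soon as C <= C' (r - |z|). *)
Lemma geometric_bound_of_recurrence (z : R[i]) r C (v : nat -> R[i]) :
  normc z < r -> (forall m, normc (v m.+1 - z * v m) <= C * r ^+ m) ->
  exists C', forall m, normc (v m) <= C' * r ^+ m.
Proof.
move=> zr hv; have r0 : 0 < r := le_lt_trans (normc_ge0 z) zr.
have rz : 0 < r - normc z by rewrite subr_gt0.
pose C' := Num.max (normc (v 0%N)) (C / (r - normc z)).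
exists C'; elim=> [|m IH]; first by rewrite mulr1 le_max lexx.
have -> : v m.+1 = (v m.+1 - z * v m) + z * v m by rewrite subrK.
apply: le_trans (normc_add _ _) _; apply: le_trans (lerD (hv m) (lexx _)) _.
rewrite Normc.normcM.
apply: (@le_trans _ _ (C * r ^+ m + normc z * (C' * r ^+ m))).
  by rewrite lerD2l ler_wpM2l ?normc_ge0.
have -> : C' * r ^+ m.+1 = (C' * (r - normc z)) * r ^+ m + normc z * (C' * r ^+ m).
  by rewrite exprS; ring.
rewrite lerD2r ler_wpM2r ?exprn_ge0 ?(ltW r0)// -ler_pdivrMr//.
by rewrite le_max lexx orbT.
Qed.

(** The factors X - z are removed one at a time. Since reduction modulo p is linear, multiplying by
    X - z acts on the sequence of remainders of g X^m as v(m+1) - z v(m), so each removal is one use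
    of the recurrence bound. *)
Lemma coef_modp_geometric (p : {poly R[i]}) (s : seq R[i]) r j :
  {in s, forall z, normc z < r} -> forall g : {poly R[i]},
  (exists C, forall m,
    normc ((g * \prod_(z <- s) ('X - z%:P) * 'X^m) %% p)`_j <= C * r ^+ m) ->
  exists C, forall m, normc ((g * 'X^m) %% p)`_j <= C * r ^+ m.
Proof.
elim: s => [|z s IH] sr g; first by rewrite big_nil mulr1.
rewrite big_cons mulrA => /IH[|C hC].
  by move=> x xs; apply: sr; rewrite inE xs orbT.
apply: (@geometric_bound_of_recurrence z r C) => [|m]; first by apply: sr; rewrite inE eqxx.
suff <- : ((g * ('X - z%:P) * 'X^m) %% p)`_j =
    ((g * 'X^(m.+1)) %% p)`_j - z * ((g * 'X^m) %% p)`_j by exact: hC.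
rewrite -coefZ -modpZl -coefB -modpN -modpD; congr ((_ %% _)`_ _).
by rewrite -mul_polyC exprS; ring.
Qed.

Lemma coef_exp_mod_char_poly d (B : 'M[R]_d.+1) r : spectral_radius B < r ->
  exists C, forall m (j : 'I_d.+1), `|('X^m %% char_poly B)`_j| <= C * r ^+ m.
Proof.
move=> Br; have r0 : 0 < r := le_lt_trans (spectral_radius_ge0 B) Br.
pose p := char_poly (map_mx (real_complex R) B).
have [s] := closed_field_poly_normal p.
rewrite (monicP (char_poly_monic _)) scale1r => ps.
have sr : {in s, forall z, normc z < r}.
  move=> z zs; apply: le_lt_trans Br; apply: eigenvalue_le_spectral_radius.
  by rewrite eigenvalue_root_char -/p ps root_prod_XsubC.
have hC (j : 'I_d.+1) : exists C, forall m, `|('X^m %% char_poly B)`_j| <= C * r ^+ m.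
  (* With g = 1 and all the roots, the product is p itself: the initial remainders vanish and the
     constant 0 serves. *)
  have [|C hC] := @coef_modp_geometric p s r j sr 1.
    by exists 0 => m; rewrite mul1r -ps modp_mulr coef0 Normc.normc0 mul0r.
  exists C => m; apply: le_trans (hC m).
  by rewrite mul1r -normc_real -coef_map /= map_modp map_polyXn map_char_poly.
have [C {}hC] := choice hC.
exists (\sum_j `|C j|) => m j; apply: le_trans (hC j m) _.
rewrite ler_wpM2r ?exprn_ge0 ?(ltW r0)// (bigD1 j)//=.
by rewrite (le_trans (ler_norm _))// lerDl sumr_ge0.
Qed.

(** Cayley-Hamilton: X^m may be replaced by its remainder, of degree at most d, before evaluation at
    B. *)
Lemma exp_mod_char_poly d (B : 'M[R]_d.+1) m :
  B ^+ m = \sum_(j < d.+1) ('X^m %% char_poly B)`_j *: B ^+ j.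
Proof.
have -> : B ^+ m = horner_mx B ('X^m %% char_poly B).
  have -> : B ^+ m = horner_mx B 'X^m by rewrite rmorphXn /= horner_mx_X.
  rewrite [in LHS](divp_eq 'X^m (char_poly B)) rmorphD rmorphM /=.
  by rewrite Cayley_Hamilton mulr0 add0r.
rewrite [X in horner_mx B X](_ : _ = \sum_(j < d.+1) ('X^m %% char_poly B)`_j *: 'X^j).
  rewrite rmorph_sum /=; apply: eq_bigr => j _.
  by rewrite linearZ /= rmorphXn /= horner_mx_X.
rewrite -[LHS]coefK poly_def.
have sz : (size ('X^m %% char_poly B)%R <= d.+1)%N.
  by rewrite -ltnS -(size_char_poly B) ltn_modp monic_neq0// char_poly_monic.
rewrite (big_ord_widen _ (fun i => ('X^m %% char_poly B)`_i *: 'X^i) sz).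
rewrite big_mkcond; apply: eq_bigr => j _; case: ifPn => // ; rewrite -leqNgt => szj.
by rewrite nth_default// scale0r.
Qed.

(* The constant depends on the norm only through the Lipschitz bound K: this
   uniformity is what allows epsilon -> 0 in the family of adapted norms. *)
Lemma power_decay_uniform d (B : 'M[R]_d.+1) r K :
  spectral_radius B < r -> 0 <= K ->
  exists C, forall nv, is_norm nv -> (forall x, nv (B *m x) <= K * nv x) ->
  forall m x, nv (B ^+ m *m x) <= C * r ^+ m * nv x.
Proof.
move=> /coef_exp_mod_char_poly[C hC] K0.
exists (\sum_(j < d.+1) C * K ^+ j) => nv hnv hB m x.
have hBj j : nv (B ^+ j *m x) <= K ^+ j * nv x.
  elim: j => [|j IH]; first by rewrite expr0 mul1mx mul1r.
  rewrite exprS -mulmxA; apply: le_trans (hB _) _.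
  by rewrite exprS -mulrA ler_wpM2l.
rewrite exp_mod_char_poly mulmx_suml.
apply: le_trans (is_norm_sum hnv _ _) _; rewrite !mulr_suml ler_sum// => j _.
rewrite -scalemxAl (is_normZ hnv).
have -> : C * K ^+ j * r ^+ m * nv x = (C * r ^+ m) * (K ^+ j * nv x) by ring.
by apply: ler_pM => //; exact: is_norm_ge0 hnv _.
Qed.

End CharPolyRemainders.

(** The exponent is positive so that repeating a cycle that many times gives a nonempty word. *)
Lemma small_power (R : realType) (t e : R) :
  0 <= t -> t < 1 -> 0 < e -> exists m, t ^+ m.+1 <= e.
Proof.
move=> t0 t1 e0; have tn : `|t| < 1 by rewrite ger0_norm.
have [n _ hn] : \forall n \near \oo, t ^+ n <= e by exact: cvgr_le (cvg_expr tn) _ e0.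
by exists n; apply: hn => /=.
Qed.

Lemma powers_bounded_le1 (R : realType) (t C : R) :
  0 <= t -> (forall m, t ^+ m.+1 <= C) -> t <= 1.
Proof.
move=> t0 hC; rewrite leNgt; apply/negP => t1.
have tp : 0 < t := lt_trans ltr01 t1.
have C0 : 0 < C by apply: lt_le_trans (hC 0%N); rewrite expr1.
have [|||m] := @small_power R t^-1 (C + 1)^-1.
- by rewrite invr_ge0.
- by rewrite invf_lt1.
- by rewrite invr_gt0 addr_gt0.
rewrite exprVn lef_pV2 ?posrE ?exprn_gt0 ?addr_gt0// => /le_trans/(_ (hC m)).
by rewrite gerDl ler10.
Qed.

(** * Spectral radii of products along words *)

Section SpectralRadiusWord.
Variables (R : realType) (d N : nat) (nv : 'cV[R]_d.+1 -> R).
Hypothesis hnv : is_norm nv.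
Variable A : 'I_N -> 'M[R]_d.+1.

Lemma size_flatten_nseq (T : Type) m (w : seq T) :
  size (flatten (nseq m w)) = (size w * m)%N.
Proof. by elim: m => [|m IH]; rewrite ?muln0//= size_cat IH mulnS. Qed.

(** Applied to the repetitions of w, the growth bound shows that all positive powers of rho(A_w) /
    s^|w| stay below one constant, so this ratio is at most 1; then s decreases to [rho_d]. *)
Lemma spectral_radius_word_le w : w != [::] ->
  spectral_radius (word_mx A w) `^ (size w)%:R^-1 <= rho_d nv A.
Proof.
move=> w0; have k0 : (0 < size w)%N by case: w w0.
apply/ler_addgt0Pr => e e0; set s := rho_d nv A + e.
have rs : rho_d nv A < s by rewrite ltrDl.
have s0 : 0 < s := le_lt_trans (rho_d_ge0 hnv A) rs.
have sk0 : 0 < s ^+ size w by exact: exprn_gt0.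
rewrite root_powR_le ?spectral_radius_ge0 ?(ltW s0)//.
have [C C1 hC] := word_norm_growth hnv rs.
have [K K0 hK] := spectral_radius_le_norm hnv.
rewrite -[leRHS]mul1r -ler_pdivrMr//.
apply: (@powers_bounded_le1 _ _ (K * C)) => [|m].
  by rewrite divr_ge0 ?spectral_radius_ge0// ltW.
rewrite expr_div_n ler_pdivrMr ?exprn_gt0//.
apply: le_trans (spectral_radius_exp _ _) _; apply: le_trans (hK _) _.
by rewrite -mulrA ler_pM2l// -word_mx_repeat -exprM -size_flatten_nseq.
Qed.

End SpectralRadiusWord.

(** * Stationary words *)

Lemma sum_tuple_cons (V : nmodType) (T : finType) n (F : seq T -> V) :
  \sum_(w : n.+1.-tuple T) F w = \sum_x \sum_(w : n.-tuple T) F (x :: w).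
Proof.
rewrite pair_bigA /= (reindex (fun p : T * n.-tuple T => [tuple of p.1 :: p.2])) //=.
exists (fun w : n.+1.-tuple T => (thead w, [tuple of behead w])) => [[x w] _|w _] /=.
  by congr pair; exact: val_inj.
by rewrite -tuple_eta.
Qed.

Lemma sum_tuple0 (V : nmodType) (T : finType) (F : seq T -> V) :
  \sum_(w : 0.-tuple T) F w = F [::].
Proof.
rewrite (big_pred1 [tuple]) => [//|w]; apply/esym/eqP; exact: tuple0.
Qed.

Section MarkovWords.
Variables (R : realType) (N : nat) (P : 'M[R]_N) (nu : 'rV[R]_N).
Hypothesis hP : stochastic P.
Hypothesis hnu : invariant_probability nu P.

Let P_ge0 i j : 0 <= P i j. Proof. exact: (proj1 hP). Qed.
Let nu_ge0 i : 0 <= nu 0 i. Proof. by case: hnu. Qed.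

Lemma path_weight_ge0 i s : 0 <= path_weight P i s.
Proof. by elim: s i => //= j s IH i; rewrite mulr_ge0. Qed.

Lemma word_weight_ge0 w : 0 <= word_weight nu P w.
Proof. by case: w => //= i s; rewrite mulr_ge0// path_weight_ge0. Qed.

(** The letters after w sum out because the rows of P sum to 1. *)
Lemma sum_path_weight_prefix i w n : (size w <= n)%N ->
  \sum_(s : n.-tuple 'I_N) path_weight P i s * (prefix w s)%:R = path_weight P i w.
Proof.
elim: n w i => [|n IH] w i wn.
  rewrite (sum_tuple0 (fun s => path_weight P i s * (prefix w s)%:R)).
  by case: w wn => //= _; rewrite mulr1.
rewrite (sum_tuple_cons _ (fun s => path_weight P i s * (prefix w s)%:R)) /=.
have step w' : (size w' <= n)%N -> forall j,
    \sum_(s : n.-tuple 'I_N) P i j * path_weight P j s * (prefix w' s)%:R =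
    P i j * path_weight P j w'.
  move=> wn' j; rewrite -(IH w' j wn') mulr_sumr; apply: eq_bigr => s _.
  by rewrite mulrA.
case: w wn => [_|k w wn].
  rewrite -[RHS](proj2 hP i); apply: eq_bigr => j _.
  rewrite -[RHS]mulr1 -(step [::])//; apply: eq_bigr => s _.
  by rewrite !prefix0s.
rewrite (bigD1 k)//= [X in _ + X]big1 ?addr0 => [|j jk].
  by rewrite -(step w)//; apply: eq_bigr => s _; rewrite eqxx.
by rewrite big1// => s _; rewrite eq_sym (negPf jk) mulr0.
Qed.

Lemma sum_word_weight_prefix w n : (size w <= n)%N ->
  \sum_(s : n.-tuple 'I_N) word_weight nu P s * (prefix w s)%:R = word_weight nu P w.
Proof.
case: n => [|n] wn.
  rewrite (sum_tuple0 (fun s => word_weight nu P s * (prefix w s)%:R)).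
  by case: w wn => //= _; rewrite mulr1.
rewrite (sum_tuple_cons _ (fun s => word_weight nu P s * (prefix w s)%:R)) /=.
have step w' : (size w' <= n)%N -> forall j,
    \sum_(s : n.-tuple 'I_N) nu 0 j * path_weight P j s * (prefix w' s)%:R =
    nu 0 j * path_weight P j w'.
  move=> wn' j; rewrite -(sum_path_weight_prefix j wn') mulr_sumr.
  by apply: eq_bigr => s _; rewrite mulrA.
case: w wn => [_|k w wn].
  case: hnu => _ nu1 _; rewrite -[RHS]nu1; apply: eq_bigr => j _.
  rewrite -[RHS]mulr1 -(step [::])//; apply: eq_bigr => s _.
  by rewrite !prefix0s.
rewrite (bigD1 k)//= [X in _ + X]big1 ?addr0 => [|j jk].
  by rewrite -(step w)//; apply: eq_bigr => s _; rewrite eqxx.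
by rewrite big1// => s _; rewrite eq_sym (negPf jk) mulr0.
Qed.

Lemma sum_word_weight n : \sum_(w : n.-tuple 'I_N) word_weight nu P w = 1.
Proof.
rewrite -[RHS](@sum_word_weight_prefix [::] n)//; apply: eq_bigr => w _.
by rewrite prefix0s mulr1.
Qed.

(** Stationarity: summing over the forgotten first letter replaces nu by nu P, which is nu. *)
Lemma sum_word_weight_behead n (f : seq 'I_N -> R) :
  \sum_(w : n.+1.-tuple 'I_N) word_weight nu P w * f (behead w) =
  \sum_(w : n.-tuple 'I_N) word_weight nu P w * f w.
Proof.
case: hnu => _ nu1 nuP.
rewrite (sum_tuple_cons _ (fun w => word_weight nu P w * f (behead w))) /=.
(* If only one letter was present, no transition remains and the total mass of nu accounts for the
   weight 1 of the empty word. *)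
case: n => [|n].
  rewrite (sum_tuple0 (fun w => word_weight nu P w * f w)) /= -nu1 mulr_suml.
  apply: eq_bigr => i _.
  by rewrite (sum_tuple0 (fun w => nu 0 i * path_weight P i w * f w)) /= mulr1.
rewrite (sum_tuple_cons _ (fun w => word_weight nu P w * f w)) /=.
under eq_bigr => i _ do
  rewrite (sum_tuple_cons _ (fun w => nu 0 i * path_weight P i w * f w)) /=.
rewrite exchange_big; apply: eq_bigr => j _ /=.
rewrite exchange_big; apply: eq_bigr => s _ /=.
have -> : nu 0 j = \sum_i nu 0 i * P i j by rewrite {1}nuP mxE.
by rewrite !mulr_suml; apply: eq_bigr => i _; rewrite !mulrA.
Qed.

Lemma sum_word_weight_drop t n (f : seq 'I_N -> R) : (t <= n)%N ->
  \sum_(w : n.-tuple 'I_N) word_weight nu P w * f (drop t w) =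
  \sum_(w : (n - t).-tuple 'I_N) word_weight nu P w * f w.
Proof.
elim: t n => [|t IH] [|n] tn //.
- by rewrite subn0; apply: eq_bigr => w _; rewrite drop0.
- by rewrite subn0; apply: eq_bigr => w _; rewrite drop0.
rewrite subSS -IH// -(sum_word_weight_behead n (fun w => f (drop t w))).
by apply: eq_bigr => w _; rewrite -drop1 drop_drop addn1.
Qed.

Lemma sum_word_weight_occurrence w t n : (t + size w <= n)%N ->
  \sum_(s : n.-tuple 'I_N) word_weight nu P s * (prefix w (drop t s))%:R =
  word_weight nu P w.
Proof.
move=> twn; rewrite (sum_word_weight_drop (fun s => (prefix w s)%:R)); last by lia.
by apply: sum_word_weight_prefix; lia.
Qed.

End MarkovWords.

(** * Occurrences of a word in consecutive blocks *)

Section BlockHits.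
Variable N : nat.
Implicit Types (v w : seq 'I_N).

(** Only occurrences starting at multiples of [size v] count: they are disjoint, so their
    contraction factors multiply. *)
Definition block_hits v q w : nat :=
  \sum_(j < q) prefix v (drop (j * size v) w).

Lemma block_hitsS v q w :
  block_hits v q.+1 w = (prefix v w + block_hits v q (drop (size v) w))%N.
Proof.
rewrite /block_hits big_ord_recl mul0n drop0; congr addn.
by apply: eq_bigr => j _; rewrite drop_drop /= /bump /= add1n mulSn addnC.
Qed.

Lemma block_hits_le v q w : (block_hits v q w <= q)%N.
Proof.
rewrite -[leqRHS]card_ord -sum1_card leq_sum// => j _; exact: leq_b1.
Qed.

(** Linearity of expectation; by stationarity each of the q blocks equals v with the same
    probability. *)
Lemma sum_word_weight_block_hits (R : realType) (P : 'M[R]_N) (nu : 'rV[R]_N) v q n :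
  stochastic P -> invariant_probability nu P -> (q * size v <= n)%N ->
  \sum_(w : n.-tuple 'I_N) word_weight nu P w * (block_hits v q w)%:R =
  q%:R * word_weight nu P v.
Proof.
move=> hP hnu qn.
under eq_bigr => w _ do rewrite /block_hits natr_sum mulr_sumr.
rewrite exchange_big /= mulr_natl -[in RHS](card_ord q) -sumr_const.
apply: eq_bigr => j _; apply: sum_word_weight_occurrence => //.
apply: leq_trans qn; rewrite addnC -mulSn leq_mul2r ltn_ord; exact: orbT.
Qed.

End BlockHits.

(** AM-GM for n numbers, a of them equal to t and the others to s. It makes the bound on a root
    affine in the number of hits, so that its mean can be computed. *)
Lemma weighted_AGM (R : realType) (s t : R) a n : (a <= n)%N -> (0 < n)%N ->
  0 <= t -> 0 <= s ->
  s ^+ (n - a) * t ^+ a <= (s - a%:R / n%:R * (s - t)) ^+ n.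
Proof.
move=> /subnK <- n0 t0 s0; set b := (n - a)%N in n0 *.
rewrite addnK.
have h := leif_AGM (fun (i : 'I_(b + a)) (_ : i \in predT) =>
  (if (i < b)%N as c return 0 <= (if c then s else t) then s0 else t0)).
have [{}h _] := h; move: h; rewrite cardT size_enum_ord !big_split_ord /=.
have E1 (i : 'I_b) : (i < b)%N by [].
have E2 (i : 'I_a) : (b + i < b)%N = false by rewrite ltnNge leq_addr.
under eq_bigr => i _ do rewrite E1.
under [X in _ * X]eq_bigr => i _ do rewrite E2.
under [X in X + _]eq_bigr => i _ do rewrite E1.
under [X in _ + X]eq_bigr => i _ do rewrite E2.
rewrite !prodr_const !sumr_const !card_ord => /le_trans; apply.
rewrite le_eqVlt; apply/orP; left; apply/eqP; congr (_ ^+ _).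
have nz : b%:R + a%:R != 0 :> R by rewrite -natrD pnatr_eq0 -lt0n.
rewrite -(mulr_natr s) -(mulr_natr t) natrD; apply: (mulIf nz); rewrite divfK//.
rewrite mulrBl mulrAC divfK//; ring.
Qed.

(** * Adapted norms *)

Section AdaptedNorm.
Variables (R : realType) (d N : nat) (nv : 'cV[R]_d -> R).
Hypothesis hnv : is_norm nv.
Variables (A : 'I_N -> 'M[R]_d) (s C : R).
Hypothesis s0 : 0 < s.
Hypothesis growth : forall w, induced_norm nv (word_mx A w) <= C * s ^+ size w.

(** The [growth] hypothesis makes this supremum finite; the empty word makes it dominate [nv]. *)
Definition adapted_norm (x : 'cV[R]_d) : R :=
  sup [set nv (word_mx A w *m x) / s ^+ size w | w in [set: seq 'I_N]].

Let nv_ge0 := is_norm_ge0 hnv.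

Let term_le x w : nv (word_mx A w *m x) / s ^+ size w <= C * nv x.
Proof.
rewrite ler_pdivrMr ?exprn_gt0// mulrAC.
apply: le_trans (induced_norm_mulmx hnv _ _) _.
by rewrite ler_wpM2r.
Qed.

Lemma adapted_norm_ge x w :
  nv (word_mx A w *m x) / s ^+ size w <= adapted_norm x.
Proof.
apply: ub_le_sup; last by exists w.
by exists (C * nv x) => _ [w' _ <-]; exact: term_le.
Qed.

Lemma adapted_norm_lub x b :
  (forall w, nv (word_mx A w *m x) / s ^+ size w <= b) -> adapted_norm x <= b.
Proof.
move=> hb; apply: ge_sup; last by move=> _ [w _ <-]; exact: hb.
by exists (nv (word_mx A [::] *m x) / s ^+ 0), [::].
Qed.

Lemma le_adapted_norm x : nv x <= adapted_norm x.
Proof. by have := adapted_norm_ge x [::]; rewrite /word_mx /= mul1mx divr1. Qed.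

Lemma adapted_norm_le x : adapted_norm x <= C * nv x.
Proof. exact: adapted_norm_lub. Qed.

Lemma is_norm_adapted : is_norm adapted_norm.
Proof.
have ge0 x : 0 <= adapted_norm x by exact: le_trans (le_adapted_norm x).
have leZ a x : adapted_norm (a *: x) <= `|a| * adapted_norm x.
  apply: adapted_norm_lub => w; rewrite -scalemxAr (is_normZ hnv) -mulrA.
  by rewrite ler_wpM2l ?adapted_norm_ge.
have nx0 x : adapted_norm x = 0 -> x = 0.
  move=> x0; apply: (is_norm_eq0 hnv); apply/eqP; rewrite eq_le nv_ge0 andbT.
  by rewrite -x0 le_adapted_norm.
split=> // [a x|x y].
  apply/eqP; rewrite eq_le leZ /=; have [->|a0] := eqVneq a 0.
    by rewrite normr0 mul0r.
  rewrite mulrC -ler_pdivlMr ?normr_gt0// mulrC -normfV.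
  by apply: le_trans (leZ _ _); rewrite scalerA mulVf// scale1r.
apply: adapted_norm_lub => w; rewrite mulmxDr.
apply: le_trans (lerD (adapted_norm_ge x w) (adapted_norm_ge y w)).
by rewrite -mulrDl ler_wpM2r ?invr_ge0 ?exprn_ge0 ?(ltW s0)// (is_normD hnv).
Qed.

(** The terms for A_i x are, up to the factor s, the terms for x at the words starting with i. *)
Lemma adapted_norm_generator i x : adapted_norm (A i *m x) <= s * adapted_norm x.
Proof.
apply: adapted_norm_lub => w; rewrite mulmxA -word_mx_cons -ler_pdivrMl//.
by rewrite mulrC -mulrA -invfM -exprSr; exact: (adapted_norm_ge x (i :: w)).
Qed.

End AdaptedNorm.

(** * Upper bound on the probabilistic radius from a contracting word *)

Section UpperBound.
Variables (R : realType) (d N : nat) (A : 'I_N -> 'M[R]_d).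

Section Contraction.
Variables (nv : 'cV[R]_d -> R) (s t : R) (v : seq 'I_N).
Hypothesis s0 : 0 <= s.
Hypothesis t0 : 0 <= t.
Hypothesis hs : forall i x, nv (A i *m x) <= s * nv x.
Hypothesis hv : forall x, nv (word_mx A v *m x) <= t ^+ size v * nv x.

Lemma generators_word_le w x : nv (word_mx A w *m x) <= s ^+ size w * nv x.
Proof.
elim: w x => [|i w IH] x; first by rewrite /word_mx /= mul1mx mul1r.
rewrite word_mx_cons -mulmxA; apply: le_trans (IH _) _.
by rewrite /= exprSr -mulrA ler_wpM2l ?exprn_ge0.
Qed.

(** The word is read block by block: a block equal to v costs t per letter, while any other block
    and the final tail cost s per letter. *)
Lemma block_hits_word_le q w x : (q * size v <= size w)%N ->
  nv (word_mx A w *m x) <=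
  s ^+ (size w - block_hits v q w * size v) * t ^+ (block_hits v q w * size v) * nv x.
Proof.
elim: q w x => [|q IH] w x qw.
  rewrite /block_hits big_ord0 mul0n subn0 mulr1; exact: generators_word_le.
rewrite block_hitsS -[in leLHS](cat_take_drop (size v) w) word_mx_cat -mulmxA.
set h := block_hits v q _.
have hq : (h * size v <= q * size v)%N by rewrite leq_mul2r block_hits_le orbT.
rewrite mulSn in qw.
have dw : size (drop (size v) w) = (size w - size v)%N by rewrite size_drop.
apply: le_trans (IH _ _ _) _; first by rewrite dw; lia.
rewrite dw -/h; have st0 a b : 0 <= s ^+ a * t ^+ b by rewrite mulr_ge0 ?exprn_ge0.
rewrite prefixE; case: eqP => [->|_].
  rewrite mulSn exprD.
  have -> : (size w - (size v + h * size v) = size w - size v - h * size v)%N by lia.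
  apply: (le_trans (ler_wpM2l (st0 _ _) (hv x))).
  by rewrite le_eqVlt; apply/orP; left; apply/eqP; ring.
have -> : (size w - (0 + h) * size v = size w - size v - h * size v + size v)%N.
  by rewrite add0n; lia.
apply: (le_trans (ler_wpM2l (st0 _ _) (generators_word_le _ _))).
rewrite size_takel; last by lia.
by rewrite exprD add0n le_eqVlt; apply/orP; left; apply/eqP; ring.
Qed.

End Contraction.

Variables (nv nv' : 'cV[R]_d -> R) (P : 'M[R]_N) (nu : 'rV[R]_N).
Hypothesis hnv : is_norm nv.
Hypothesis hP : stochastic P.
Hypothesis hnu : invariant_probability nu P.

Definition mean_root (n : nat) : R :=
  \sum_(w : n.-tuple 'I_N)
    word_weight nu P w * induced_norm nv (word_mx A w) `^ n%:R^-1.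

Lemma mean_root_le_max n : mean_root n <= max_root nv A n.
Proof.
rewrite -[leRHS]mul1r -(sum_word_weight hP hnu n) mulr_suml.
apply: ler_sum => w _; rewrite ler_wpM2l ?(word_weight_ge0 hP hnu)//.
by have := root_word_norm_le_max nv A w; rewrite size_tuple.
Qed.

Lemma mean_root_bounds n : 0 <= mean_root n <= generator_bound nv A.
Proof.
rewrite (le_trans (mean_root_le_max n)) ?andbT; last first.
  by have /andP[] := max_root_bounds hnv A n.
by rewrite sumr_ge0// => w _; rewrite mulr_ge0 ?powR_ge0 ?(word_weight_ge0 hP hnu).
Qed.

Lemma rho_p_le_rho_d : rho_p nv nu P A <= rho_d nv A.
Proof.
apply: (limn_sup_le_limn_sup mean_root_bounds (max_root_bounds hnv A)).
exact: mean_root_le_max.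
Qed.

Variables (s t C : R) (v : seq 'I_N).
Hypothesis t0 : 0 <= t.
Hypothesis ts : t <= s.
Hypothesis hs : forall i x, nv' (A i *m x) <= s * nv' x.
Hypothesis v0 : v != [::].
Hypothesis hv : forall x, nv' (word_mx A v *m x) <= t ^+ size v * nv' x.
Hypothesis C1 : 1 <= C.
Hypothesis nv_le : forall x, nv x <= nv' x.
Hypothesis nv_ge : forall x, nv' x <= C * nv x.

(** Passing from [nv] to [nv'] and back costs the factor C. AM-GM then bounds each root by an affine
    function of the number of hits, whose mean is known. *)
Lemma mean_root_le n : (0 < n)%N ->
  mean_root n <= C `^ n%:R^-1 *
    (s - word_weight nu P v * (1 - (size v)%:R / n%:R) * (s - t)).
Proof.
move=> n0; set L := size v; have L0 : (0 < L)%N by rewrite /L; case: v v0.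
have s0 : 0 <= s := le_trans t0 ts.
have C0 : 0 <= C := le_trans ler01 C1.
have nR : 0 < n%:R :> R by rewrite ltr0n.
set q := (n %/ L)%N; have qn : (q * L <= n)%N by exact: leq_divM.
pose f (w : seq 'I_N) : R := s - (block_hits v q w * L)%:R / n%:R * (s - t).
have root_le (w : n.-tuple 'I_N) :
    induced_norm nv (word_mx A w) `^ n%:R^-1 <= C `^ n%:R^-1 * f w.
  have hqL : (block_hits v q w * L <= n)%N.
    by apply: leq_trans qn; rewrite leq_mul2r block_hits_le orbT.
  (* The hits cover at most n letters, so [f w] is at least t. *)
  have f0 : 0 <= f w.
    rewrite subr_ge0; apply: (@le_trans _ _ (1 * (s - t))).
      by rewrite ler_wpM2r ?subr_ge0// ler_pdivrMr// mul1r ler_nat.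
    by rewrite mul1r lerBlDr lerDl.
  rewrite root_powR_le ?induced_norm_ge0 ?mulr_ge0 ?powR_ge0//.
  rewrite exprMn root_powR_expn//; apply: induced_norm_le => // [|x].
    by rewrite mulr_ge0 ?exprn_ge0.
  apply: le_trans (nv_le _) _.
  apply: le_trans (block_hits_word_le (q := q) s0 t0 hs hv x _) _.
    by rewrite size_tuple.
  rewrite size_tuple -/L.
  have AG := weighted_AGM hqL n0 t0 s0.
  apply: (@le_trans _ _ (f w ^+ n * nv' x)).
    by rewrite ler_wpM2r// (le_trans (is_norm_ge0 hnv x)).
  by rewrite mulrAC [leRHS]mulrC ler_wpM2l ?exprn_ge0.
apply: (@le_trans _ _ (\sum_(w : n.-tuple 'I_N)
    word_weight nu P w * (C `^ n%:R^-1 * f w))).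
  by apply: ler_sum => w _; rewrite ler_wpM2l ?(word_weight_ge0 hP hnu).
under eq_bigr => w _ do rewrite mulrCA.
rewrite -mulr_sumr ler_wpM2l ?powR_ge0//.
have -> : \sum_(w : n.-tuple 'I_N) word_weight nu P w * f w =
    s - L%:R / n%:R * (s - t) * (q%:R * word_weight nu P v).
  rewrite -(sum_word_weight_block_hits hP hnu qn).
  rewrite -[X in _ = X - _]mulr1 -[X in _ = s * X - _](sum_word_weight hP hnu n).
  rewrite !mulr_sumr -sumrB; apply: eq_bigr => w _.
  by rewrite /f natrM; ring.
have -> : L%:R / n%:R * (s - t) * (q%:R * word_weight nu P v) =
  word_weight nu P v * ((q * L)%:R / n%:R) * (s - t) by rewrite natrM; ring.
rewrite lerD2l lerN2 ler_wpM2r ?subr_ge0// ler_wpM2l ?(word_weight_ge0 hP hnu)//.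
(* Only the last incomplete block is lost, whence n <= q L + L. *)
rewrite ler_pdivlMr// mulrBl mul1r divfK ?gt_eqF// lerBlDr -natrD ler_nat.
by rewrite {1}(divn_eq n L) leq_add2l ltnW// ltn_mod.
Qed.

Lemma rho_p_le_of_contraction :
  rho_p nv nu P A <= s - word_weight nu P v * (s - t).
Proof.
have near_le : \forall n \near \oo, mean_root n <= C `^ n%:R^-1 *
    (s - word_weight nu P v * (1 - (size v)%:R / n%:R) * (s - t)).
  by exists 1%N => // n; exact: mean_root_le.
apply: (limn_sup_le_cvg mean_root_bounds near_le).
rewrite -[X in _ --> X]mul1r; apply: cvgM.
  by apply: cvg_root_powR; exact: lt_le_trans C1.
apply: cvgB; first exact: cvg_cst.
apply: cvgM; last exact: cvg_cst.
rewrite -[X in _ --> X]mulr1; apply: cvgM; first exact: cvg_cst.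
rewrite -[X in _ --> X]subr0; apply: cvgB; first exact: cvg_cst.
rewrite -[X in _ --> X](mulr0 (size v)%:R).
by apply: cvgM; [exact: cvg_cst|exact: cvg_inv_natr].
Qed.

End UpperBound.

(** * Recurrence and closing of words *)

Section Recurrence.
Variables (R : realType) (N : nat) (P : 'M[R]_N) (nu : 'rV[R]_N).
Hypothesis hP : stochastic P.
Hypothesis hnu : invariant_probability nu P.

Definition step : rel 'I_N := fun i j => 0 < P i j.

Lemma path_weight_gt0 i s : (0 < path_weight P i s) = path step i s.
Proof.
elim: s i => [|j s IH] i /=; first by rewrite ltr01.
rewrite -IH /step; apply/idP/andP => [|[Pij js]]; last by rewrite mulr_gt0.
have := proj1 hP i j; rewrite le_eqVlt => /predU1P[<-|Pij].
  by rewrite mul0r ltxx.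
by rewrite pmulr_rgt0.
Qed.

Lemma nu_step i j : 0 < nu 0 i -> step i j -> 0 < nu 0 j.
Proof.
case: hnu => nu0 _ nuP ni ij; rewrite nuP mxE (bigD1 i)//= ltr_pwDl ?mulr_gt0//.
by rewrite sumr_ge0// => k _; rewrite mulr_ge0 ?(proj1 hP).
Qed.

(* Mass balance: no mass of nu can flow from outside into a closed set of
   states, since the closed set retains all of its own mass. *)
Lemma nu_no_inflow j a b : connect step j b -> 0 < nu 0 a -> step a b ->
  connect step j a.
Proof.
case: hnu => nu0 _ nuP jb na ab; apply: contraLR na => ja.
pose S := [pred x | connect step j x].
pose c x := \sum_(y | y \in S) P x y.
have cS x : x \in S -> c x = 1.
  move=> xS; rewrite -(proj2 hP x) [RHS](bigID (mem S)) /= [X in _ + X]big1 ?addr0//.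
  move=> y yS; apply/eqP; rewrite eq_le (proj1 hP) andbT leNgt.
  by apply: contra yS => xy; apply: connect_trans xS (connect1 xy).
have c0 x : 0 <= c x by rewrite sumr_ge0// => y _; exact: (proj1 hP).
have : \sum_(x | x \in S) nu 0 x = \sum_(x | x \in S) nu 0 x +
    \sum_(x | x \notin S) nu 0 x * c x.
  rewrite [LHS](eq_bigr (fun y => \sum_x nu 0 x * P x y)) => [|y _]; last first.
    by rewrite {1}nuP mxE.
  rewrite exchange_big /= (bigID (mem S)) /=; congr (_ + _); apply: eq_bigr => x xS.
    by rewrite -mulr_sumr -/(c x) cS// mulr1.
  by rewrite -mulr_sumr.
rewrite -[LHS]addr0 => /addrI/esym/eqP.
rewrite psumr_eq0 => [|x _]; last by rewrite mulr_ge0.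
move=> /allP/(_ a (mem_index_enum _)); rewrite inE ja /= mulf_eq0 => /orP[/eqP->|].
  by rewrite ltxx.
rewrite psumr_eq0 => [|y _]; last exact: (proj1 hP).
move=> /allP/(_ b (mem_index_enum _)); rewrite inE jb /= => /eqP ab0.
by move: ab; rewrite /step ab0 ltxx.
Qed.

(** Along a path from i to j every state is charged by nu, so the absence of inflow reverses the
    steps one by one, starting from j. *)
Lemma nu_recurrent i j : 0 < nu 0 i -> connect step i j -> connect step j i.
Proof.
move=> ni /connectP[s]; elim: s i ni => [|k s IH] i ni /= => [_ ->//|/andP[ik ks] jE].
have nk := nu_step ni ik.
exact: nu_no_inflow (IH k nk ks jE) ni ik.
Qed.

Lemma return_word i j : 0 < nu 0 i -> connect step i j ->
  exists u, path step j (rcons u i).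
Proof.
move=> ni ij.
(* A forward step is taken first so that the return path is nonempty even when j = i. *)
have [k jk] : exists k, step j k.
  apply/existsP; apply: contraTT (@oner_neq0 R) => /existsPn noP; rewrite negbK.
  rewrite -(proj2 hP j) big1// => k _; apply/eqP.
  by rewrite eq_le (proj1 hP) andbT leNgt; exact: noP.
have /connectP[s ks iE] := nu_recurrent ni (connect_trans ij (connect1 jk)).
exists (belast k s); have := lastI k s; rewrite -iE => <-.
by rewrite /= jk.
Qed.

(** Successive copies of w are joined by the closing edge of the cycle. *)
Lemma word_weight_repeat w m : nu_P_cycle nu P w ->
  0 < word_weight nu P (flatten (nseq m.+1 w)).
Proof.
case: w => [|i s] [] //= cyc ni; rewrite mulr_gt0// path_weight_gt0.
move: cyc; rewrite path_weight_gt0 => cyc.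
elim: m => [|m IH]; first by rewrite cats0; move: cyc; rewrite rcons_path => /andP[].
by rewrite /= -cat_rcons cat_path cyc last_rcons.
Qed.

End Recurrence.

(** * Lower bound on the probabilistic radius under the cycle condition *)

Section LowerBound.
Variables (R : realType) (d N : nat) (nv : 'cV[R]_d.+1 -> R).
Hypothesis hnv : is_norm nv.
Variables (P : 'M[R]_N) (nu : 'rV[R]_N) (A : 'I_N -> 'M[R]_d.+1).
Hypothesis hP : stochastic P.
Hypothesis hnu : invariant_probability nu P.
Hypothesis cycles : forall w : seq 'I_N, nu_P_cycle nu P w ->
  spectral_radius (word_mx A w) `^ (size w)%:R^-1 = rho_d nv A.

(* Closing up a word of positive weight by a return word of bounded length
   yields a cycle, whose spectral radius is known. *)
Lemma word_norm_lower_bound : 0 < rho_d nv A -> exists2 c, 0 < c &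
  forall w, w != [::] -> 0 < word_weight nu P w ->
  c * rho_d nv A ^+ size w <= induced_norm nv (word_mx A w).
Proof.
set rho := rho_d nv A => rho0.
(* One return word is fixed for each pair of states, so that finiteness bounds their lengths. *)
have /choice[u hu] : forall p : 'I_N * 'I_N, exists u, 0 < nu 0 p.1 ->
    connect (step P) p.1 p.2 -> path (step P) p.2 (rcons u p.1).
  move=> [i j] /=; have [[ni ij]|nij] := pselect (0 < nu 0 i /\ connect (step P) i j).
    by have [u hu] := return_word hP hnu ni ij; exists u.
  by exists [::] => ni ij; case: nij.
pose L := \max_p size (u p).
have uL p : (size (u p) <= L)%N by exact: leq_bigmax.
have [C C0 hC] := spectral_radius_le_norm hnv.
pose b := generator_bound nv A; have b1 : 1 <= b := generator_bound_ge1 hnv A.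
have b0 : 0 < b := lt_le_trans ltr01 b1.
(* As [rho] may lie on either side of 1, m^L serves as a lower bound of rho^l for every l <= L. *)
pose m := Num.min 1 rho; have m0 : 0 < m by rewrite lt_min ltr01.
have m1 : m <= 1 by rewrite ge_min lexx.
have mrho : m <= rho by rewrite ge_min lexx orbT.
exists (m ^+ L / (C * b ^+ L)); first by rewrite divr_gt0 ?mulr_gt0 ?exprn_gt0.
move=> [//|i s] _ /= nis.
have [ni is_] : 0 < nu 0 i /\ path (step P) i s.
  have [nu0 _ _] := hnu.
  have ni : 0 < nu 0 i.
    rewrite lt_neqAle nu0 andbT eq_sym; apply: contraTneq nis => ->.
    by rewrite mul0r ltxx.
  by split=> //; rewrite -(path_weight_gt0 hP) -(pmulr_rgt0 _ ni).
set v := u (i, last i s).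
have cyc : nu_P_cycle nu P (i :: s ++ v).
  split=> //=; rewrite (path_weight_gt0 hP) rcons_cat cat_path is_ /=.
  by apply: (hu (i, last i s)) => //; apply/connectP; exists s.
have := cycles cyc; set w := i :: s => rhoE.
have sz : size (i :: s ++ v) = (size w + size v)%N by rewrite /= size_cat addSn.
have : rho ^+ size w * m ^+ L <= C * b ^+ L * induced_norm nv (word_mx A w).
  apply: (@le_trans _ _ (rho ^+ (size w + size v))).
    rewrite exprD ler_wpM2l ?exprn_ge0 ?(ltW rho0)//.
    apply: (@le_trans _ _ (m ^+ size v)).
      by apply: ler_wiXn2l => //; [exact: ltW|exact: uL].
    by rewrite lerXn2r// nnegrE ltW.
  rewrite -sz -[rho]rhoE root_powR_expn ?spectral_radius_ge0//.
  apply: le_trans (hC _) _; rewrite -mulrA ler_pM2l//.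
  rewrite -cat_cons word_mx_cat; apply: le_trans (induced_normM hnv _ _) _.
  rewrite ler_wpM2r ?induced_norm_ge0//; apply: le_trans (word_norm_le hnv A _) _.
  by rewrite ler_weXn2l// uL.
by move=> bd; rewrite mulrAC ler_pdivrMr ?mulr_gt0 ?exprn_gt0// mulrC [leRHS]mulrC.
Qed.

(** The case [rho_d] = 0 is immediate. Otherwise the lower bound on norms is averaged over the words
    of positive weight, and c^(1/n) tends to 1. *)
Lemma rho_d_le_rho_p : rho_d nv A <= rho_p nv nu P A.
Proof.
have bds := mean_root_bounds A hnv hP hnu.
have := rho_d_ge0 hnv A; rewrite le_eqVlt => /predU1P[<-|rho0].
  by apply: (limn_sup_ge_frequently bds) => n; exists n => //; have /andP[] := bds n.
have [c c0 hc] := word_norm_lower_bound rho0.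
have near_ge : \forall n \near \oo, c `^ n%:R^-1 * rho_d nv A <= mean_root A nv P nu n.
  exists 1%N => // n /= n0; rewrite -[leLHS]mul1r.
  rewrite -[X in X * _ <= _](sum_word_weight hP hnu n) mulr_suml.
  apply: ler_sum => w _; have := word_weight_ge0 hP hnu w.
  rewrite le_eqVlt => /predU1P[<-|w0]; first by rewrite !mul0r.
  rewrite ler_pM2l// root_powR_ge ?induced_norm_ge0 ?mulr_ge0 ?powR_ge0 ?(ltW rho0)//.
  rewrite exprMn (root_powR_expn n0 (ltW c0)).
  by have := hc w; rewrite -size_eq0 size_tuple -lt0n; apply.
apply: (limn_sup_ge_cvg bds near_ge); rewrite -[X in _ --> X]mul1r.
by apply: cvgM; [exact: cvg_root_powR|exact: cvg_cst].
Qed.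

End LowerBound.

(** * Strict inequality in the presence of a contracting cycle *)

Section CycleContraction.
Variables (R : realType) (d N : nat) (nv : 'cV[R]_d.+1 -> R).
Hypothesis hnv : is_norm nv.
Variables (P : 'M[R]_N) (nu : 'rV[R]_N) (A : 'I_N -> 'M[R]_d.+1).
Hypothesis hP : stochastic P.
Hypothesis hnu : invariant_probability nu P.

Lemma rho_p_lt_rho_d w : nu_P_cycle nu P w ->
  spectral_radius (word_mx A w) `^ (size w)%:R^-1 < rho_d nv A ->
  rho_p nv nu P A < rho_d nv A.
Proof.
set B := word_mx A w; set rho := rho_d nv A; set a := _ `^ _ => cyc arho.
have w0 : w != [::] by case: w {B a arho} cyc => [[]|].
have k0 : (0 < size w)%N by case: w w0 {B a arho cyc}.
have a0 : 0 <= a by exact: powR_ge0.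
pose t := (a + rho) / 2.
have at_ : a < t by rewrite /t; lra.
have trho : t < rho by rewrite /t; lra.
have t0 : 0 < t := le_lt_trans a0 at_.
have rho0 : 0 < rho := lt_trans t0 trho.
have Bt : spectral_radius B < t ^+ size w.
  rewrite -(root_powR_expn k0 (spectral_radius_ge0 B)) -/a.
  by rewrite ltr_pXn2r// nnegrE ltW.
(* The gap between r and t^|w| lets a high power absorb the constant C of the decay estimate. *)
pose r := (spectral_radius B + t ^+ size w) / 2.
have Br : spectral_radius B < r by rewrite /r; lra.
have rt : r < t ^+ size w by rewrite /r; lra.
have r0 : 0 < r := le_lt_trans (spectral_radius_ge0 B) Br.
have tk0 : 0 < t ^+ size w := lt_trans r0 rt.
(* Lipschitz bound of A_w in all adapted norms with e <= 1, hence fixed before e. *)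
pose K := (rho + 1) ^+ size w.
have K0 : 0 <= K by rewrite exprn_ge0// addr_ge0// ltW.
have [C hC] := power_decay_uniform Br K0.
have C1 : 0 < `|C| + 1 by rewrite ltr_wpDl.
have [m hm] : exists m, (r / t ^+ size w) ^+ m.+1 <= (`|C| + 1)^-1.
  apply: small_power; rewrite ?invr_gt0//; first by rewrite divr_ge0// ltW.
  by rewrite ltr_pdivrMr// mul1r.
have Crt : C * r ^+ m.+1 <= (t ^+ size w) ^+ m.+1.
  rewrite expr_div_n ler_pdivrMr ?exprn_gt0// in hm.
  rewrite ler_pdivlMl// in hm; apply: le_trans _ hm.
  by rewrite ler_wpM2r ?exprn_ge0 ?(ltW r0)// (le_trans (ler_norm _))// lerDl.
set v := flatten (nseq m.+1 w).
have v0 : v != [::] by rewrite -size_eq0 size_flatten_nseq -lt0n muln_gt0 k0.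
set p := word_weight nu P v; have p0 : 0 < p by exact: word_weight_repeat.
(* The loss e stays below the gain p (rho - t), since p and t do not depend on e. *)
pose e := Num.min 1 (p * (rho - t) / 2).
have pt0 : 0 < p * (rho - t) by rewrite mulr_gt0// subr_gt0.
have e0 : 0 < e by rewrite lt_min ltr01 divr_gt0.
have e1 : e <= 1 by rewrite ge_min lexx.
have ep : e <= p * (rho - t) / 2 by rewrite ge_min lexx orbT.
have rs : rho < rho + e by rewrite ltrDl.
have s0 : 0 < rho + e := lt_trans rho0 rs.
have [C' C'1 growth] := word_norm_growth hnv rs.
pose nv' := adapted_norm nv A (rho + e).
have hnv' : is_norm nv' := is_norm_adapted hnv s0 growth.
have hs i x : nv' (A i *m x) <= (rho + e) * nv' x.
  exact: (adapted_norm_generator hnv s0 growth).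
have hv x : nv' (word_mx A v *m x) <= t ^+ size v * nv' x.
  rewrite /v word_mx_repeat size_flatten_nseq exprM -/B.
  apply: (@le_trans _ _ (C * r ^+ m.+1 * nv' x)); last first.
    by rewrite ler_wpM2r ?(is_norm_ge0 hnv').
  apply: hC => // y; apply: le_trans (generators_word_le (ltW s0) hs _ _) _.
  rewrite ler_wpM2r ?(is_norm_ge0 hnv')// /K lerXn2r ?nnegrE ?(ltW s0)//.
    by rewrite addr_ge0// ltW.
  by rewrite lerD2l.
apply: (@le_lt_trans _ _ (rho + e - p * (rho + e - t))).
  apply: (@rho_p_le_of_contraction _ _ _ A nv nv' P nu hnv hP hnu _ _ C') => //.
  - exact: ltW.
  - by rewrite ltW// (lt_trans trho).
  - exact: (le_adapted_norm hnv s0 growth).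
  - exact: (adapted_norm_le hnv s0 growth).
have : 0 < p * e by rewrite mulr_gt0.
move: ep pt0; rewrite !mulrBr mulrDr; lra.
Qed.

End CycleContraction.

Theorem theorem3p1 (R : realType) (d N : nat) (hd : (0 < d)%N) (hN : (0 < N)%N)
  (nv : 'cV[R]_d -> R) (hnv : is_norm nv)
  (P : 'M[R]_N) (hP : stochastic P)
  (nu : 'rV[R]_N) (hnu : invariant_probability nu P)
  (A : 'I_N -> 'M[R]_d) :
  rho_d nv A = rho_p nv nu P A
  <->
  (forall w : seq 'I_N, nu_P_cycle nu P w ->
     spectral_radius (word_mx A w) `^ (size w)%:R^-1 = rho_d nv A).
Proof.
(* Writing the dimension as a successor gives square matrices their ring structure and a nonempty
   complex spectrum. *)
case: d hd nv hnv A => // d _ nv hnv A; split=> [rhoE w cyc|cycles].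
  have w0 : w != [::] by case: w cyc => [[]|].
  apply/eqP; rewrite eq_le (spectral_radius_word_le hnv A w0) leNgt /=; apply/negP.
  by move/(rho_p_lt_rho_d hnv hP hnu cyc); rewrite rhoE ltxx.
apply/eqP; rewrite eq_le (rho_p_le_rho_d A hnv hP hnu) andbT.
exact: (rho_d_le_rho_p hnv hP hnu cycles).
Qed.
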